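(* Let $\alpha \in (0,2]$. For any pair of independent, identically distributed real-valued random variables $X, Y$ such that $\mathbb{E}|X|^\alpha < \infty$, one has $$\mathbb{E}|X-Y|^\alpha \le \mathbb{E}|X+Y|^\alpha.$$ *)

(* Defs.v *)
From HB Require Import structures.
From mathcomp Require Import all_boot all_order all_algebra.
From mathcomp Require Import all_classical all_reals all_analysis.

Set Implicit Arguments.
Unset Strict Implicit.
Unset Printing Implicit Defensive.

Import Order.TTheory GRing.Theory Num.Theory.
Import numFieldNormedType.Exports.

Local Open Scope classical_set_scope.
Local Open Scope ring_scope.
Local Open Scope ereal_scope.

Definition independent_RVs {d d1 d2 : measure_display}
    {T : measurableType d} {T1 : measurableType d1} {T2 : measurableType d2}
    {R : realType} (P : probability T R)
    (X : {RV P >-> T1}) (Y : {RV P >-> T2}) : Prop :=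
  forall (A : set T1) (B : set T2), measurable A -> measurable B ->
    P (X @^-1` A `&` Y @^-1` B) = P (X @^-1` A) * P (Y @^-1` B).

(* The laws are compared on measurable sets only: [P] is a total function on
   [set T], and its values on nonmeasurable sets carry no meaning. *)
Definition identically_distributed {d d' : measure_display}
    {T : measurableType d} {T' : measurableType d'}
    {R : realType} (P : probability T R) (X Y : {RV P >-> T'}) : Prop :=
  forall A : set T', measurable A -> distribution P X A = distribution P Y A.

Arguments independent_RVs {d d1 d2 T T1 T2 R} P X Y.
Arguments identically_distributed {d d' T T' R} P X Y.

(* Main.v *)
Require Import Defs.
From HB Require Import structures.
From mathcomp Require Import all_boot all_order all_algebra.
From mathcomp Require Import all_classical all_reals all_analysis.
From mathcomp Require Import measurable_realfun ring lra.

Set Implicit Arguments.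
Unset Strict Implicit.
Unset Printing Implicit Defensive.

Import Order.TTheory GRing.Theory Num.Theory.
Import numFieldNormedType.Exports.

Local Open Scope classical_set_scope.
Local Open Scope ring_scope.
Local Open Scope ereal_scope.

(* For [0 < alpha < 2], one has
   [K |x|^alpha = \int_0^oo (1 - cos (t x)) t^(-1-alpha) dt] with [0 < K < oo].
   By Tonelli the claim reduces to
   [E (1 - cos t(X - Y)) <= E (1 - cos t(X + Y))] for each [t > 0], and the
   difference of the two sides is [2 E (sin tX sin tY) = 2 (E sin tX)^2].
   For [alpha = 2] the difference is [4 E (X Y) = 4 (E X)^2]. *)

(** * Joint law of an i.i.d. pair, and positivity of tensor squares *)

(** Independence and equality of laws make the law of the pair agree with the product measure on
    measurable rectangles, and these determine a product measure. *)
Lemma joint_distributionE (d d' : measure_display) (T : measurableType d)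
    (T' : measurableType d') (R : realType) (P : probability T R)
    (X Y : {RV P >-> T'}) :
  independent_RVs P X Y -> identically_distributed P X Y ->
  forall f : T' * T' -> \bar R, measurable_fun setT f -> (forall z, 0 <= f z) ->
  \int[P]_w f (X w, Y w) = \int[distribution P X \x distribution P X]_z f z.
Proof.
move=> indXY idXY f mf f0.
have mXY : measurable_fun setT (fun w => (X w, Y w)).
  exact: measurable_fun_pair.
transitivity (\int[pushforward P (fun w => (X w, Y w))]_z f z).
  by rewrite ge0_integral_pushforward.
apply: eq_measure_integral => A mA _; apply/esym.
apply: product_measure_unique => // B C mB mC.
transitivity (distribution P X B * distribution P Y C); first exact: indXY.
by rewrite -(idXY C mC).
Qed.

(** Tonelli applied to the absolute value gives the finite product [(\int |g|)^2], hence
    integrability; Fubini then evaluates the integral as the square [(\int g)^2]. *)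
Lemma integrable_tensor_square (d : measure_display) (T : measurableType d)
    (R : realType) (mu : probability T R) (g : T -> R) :
  mu.-integrable setT (EFin \o g) ->
  (mu \x mu).-integrable setT (fun z => (g z.1 * g z.2)%:E) /\
  0 <= \int[mu \x mu]_z (g z.1 * g z.2)%:E.
Proof.
move=> ig.
have mg : measurable_fun setT g by apply/measurable_EFinP; exact: measurable_int ig.
have mgg : measurable_fun setT (fun z : T * T => (g z.1 * g z.2)%:E).
  apply/measurable_EFinP; apply: measurable_funM.
    by apply: measurableT_comp => //; exact: measurable_fst.
  by apply: measurableT_comp => //; exact: measurable_snd.
have gfin : \int[mu]_x (g x)%:E \is a fin_num by exact: integrable_fin_num.
have igg : (mu \x mu).-integrable setT (fun z => (g z.1 * g z.2)%:E).
  apply/integrable12ltyP => //=.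
  have -> : \int[mu]_x \int[mu]_y `|(g x * g y)%:E| =
      \int[mu]_x `|(g x)%:E| * \int[mu]_y `|(g y)%:E|.
    rewrite -ge0_integralZr//; last 2 first.
    - exact/measurableT_comp/measurable_EFinP.
    - exact: integral_ge0.
    apply: eq_integral => x _.
    rewrite -ge0_integralZl//; last exact/measurableT_comp/measurable_EFinP.
    by apply: eq_integral => y _; rewrite EFinM abseM.
  by move/integrableP : ig => [_] ig; apply: lte_mul_pinfty => //;
     [exact: integral_ge0 | rewrite ge0_fin_numE//; exact: integral_ge0].
split => //; rewrite -integral12_prod_meas1//.
have -> : \int[mu]_x fubini_F mu (fun z => (g z.1 * g z.2)%:E) x =
    (\int[mu]_x (g x)%:E) * (\int[mu]_x (g x)%:E).
  rewrite -[X in _ = _ * X](fineK gfin) -integralZr//; apply: eq_integral => x _.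
  by rewrite /fubini_F /= (fineK gfin) -integralZl.
by rewrite -(fineK gfin) -EFinM lee_fin -expr2 sqr_ge0.
Qed.

(** Common core of the cosine and the quadratic comparisons: [f] is the integrand built on [x - y],
    [h] the one built on [x + y]. *)
Lemma le_integral_tensor_square (d : measure_display) (T : measurableType d)
    (R : realType) (mu : probability T R) (g : T -> R) (c : R)
    (f h : T * T -> R) :
  (0 <= c)%R -> mu.-integrable setT (EFin \o g) ->
  measurable_fun setT f -> measurable_fun setT h ->
  (forall z, 0 <= h z)%R ->
  (forall z, h z = f z + c * (g z.1 * g z.2))%R ->
  \int[mu \x mu]_z (f z)%:E <= \int[mu \x mu]_z (h z)%:E.
Proof.
move=> c0 ig mf mh h0 hE.
have [igg gg0] := integrable_tensor_square ig.
(* An infinite right-hand side is trivial. Otherwise [h] is integrable, so [f] can be written as a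
   difference of two integrable functions. *)
have [->|hlty] := eqVneq (\int[mu \x mu]_z (h z)%:E) +oo; first by rewrite leey.
have ih : (mu \x mu).-integrable setT (EFin \o h).
  apply/integrableP; split; first exact/measurable_EFinP.
  under eq_integral do rewrite /= ger0_norm//.
  by rewrite ltey.
have -> : \int[mu \x mu]_z (f z)%:E = \int[mu \x mu]_z
    ((h z)%:E - c%:E * (g z.1 * g z.2)%:E).
  by apply: eq_integral => z _; rewrite -EFinM -EFinB hE addrK.
rewrite integralB//; last exact: integrableZl.
rewrite integralZl// leeBlDr; last first.
  by rewrite fin_numM//; exact: integrable_fin_num.
by rewrite leeDl// mule_ge0.
Qed.

(** * Integral representation of [|x|^alpha] *)

(** The half-angle formula [1 - cos t = 2 sin^2 (t/2)] combines with [|sin s| <= s], a consequence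
    of the mean value theorem. With [t = e^u], the bound [2] serves near [+oo] and [t^2] near
    [-oo]. *)
Lemma cos_bound (R : realType) (t : R) : (0 <= 1 - cos t <= Num.min 2 (t ^+ 2))%R.
Proof.
have sin_bound (s : R) : (0 <= s)%R -> (`|sin s| <= s)%R.
  rewrite le_eqVlt => /predU1P[<-|s0]; first by rewrite sin0 normr0.
  have [|c _] := @MVT R sin cos 0 s s0 (fun x _ => is_derive_sin x).
    by apply: continuous_subspaceT => x; exact: continuous_sin.
  rewrite sin0 !subr0 => ->; rewrite normrM (gtr0_norm s0).
  by rewrite ler_piMl ?cos_max// ltW.
have c1 := cos_le1 t; have cN1 := cos_geN1 t.
rewrite le_min subr_ge0 c1/=; apply/andP; split; first by lra.
(* Passing to [|t|] keeps the half angle nonnegative, as [sin_bound] requires. *)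
have -> : cos t = cos ((`|t| / 2) *+ 2) by rewrite -mulr_natr divfK// cos_norm.
have := sin_bound (`|t| / 2)%R (divr_ge0 (normr_ge0 _) (ler0n _ _)).
rewrite cos_mulr2n cos2sin2 -(ler_pXn2r (n:=2)) ?nnegrE ?divr_ge0// real_normK ?num_real//.
rewrite expr_div_n real_normK ?num_real// => H.
have := sqr_ge0 t; rewrite -mulr_natr; lra.
Qed.

(* The substitution [t = e^u] turns [(1 - cos (t x)) t^(-1-alpha) dt] on
   [t > 0] into [levy_kernel alpha x u du] on the whole line, so that the
   homogeneity in [x] becomes translation invariance in [u]. *)
Definition levy_kernel (R : realType) (alpha x u : R) : R :=
  (1 - cos (expR u * x)) * expR (- alpha * u).

Section levy_representation.
Context (R : realType) (alpha : R).
Context (alpha02 : (0 < alpha < 2)%R).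
Let lambda := @lebesgue_measure R.

Lemma levy_kernel_ge0 (x u : R) : (0 <= levy_kernel alpha x u)%R.
Proof.
by rewrite mulr_ge0 ?expR_ge0//; case/andP : (cos_bound (expR u * x)%R).
Qed.

Lemma measurable_levy_kernel :
  measurable_fun setT (fun z : R * R => levy_kernel alpha z.1 z.2).
Proof.
have mE := continuous_measurable_fun (@continuous_expR R).
have mC := continuous_measurable_fun (@continuous_cos R).
apply: measurable_funM.
  apply: measurable_funB => //; apply: measurableT_comp => //.
  apply: measurable_funM; last exact: measurable_fst.
  by apply: measurableT_comp => //; exact: measurable_snd.
apply: measurableT_comp => //; exact: measurable_funM.
Qed.

Lemma continuous_levy_kernel (x : R) : continuous (levy_kernel alpha x).
Proof.
move=> u; apply: cvgM.
  apply: cvgB; first exact: cvg_cst.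
  apply: (continuous_comp (f := fun u : R => (expR u * x)%R)); last exact: continuous_cos.
  apply: cvgM; [exact: continuous_expR|exact: cvg_cst].
apply: (continuous_comp (f := fun u : R => (- alpha * u)%R)); last exact: continuous_expR.
exact: mulrl_continuous.
Qed.

Definition levy_constant : \bar R := \int[lambda]_u (levy_kernel alpha 1 u)%:E.

(** The kernel is at most [2 e^(-alpha u)] for [u >= 0], integrable since [alpha > 0], and at most
    [e^((2 - alpha) u)] for [u < 0], integrable since [alpha < 2]. *)
Lemma levy_constant_lty : levy_constant < +oo.
Proof.
case/andP: alpha02 => a0 a2; have b0 : (0 < 2 - alpha)%R by rewrite subr_gt0.
(* The two bounds are multiples of an exponential density and of a reflected one, each of total mass
   1. *)
pose p1 (u : R) := exponential_pdf alpha u.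
pose p2 (u : R) := exponential_pdf (2 - alpha)%R (- u)%R.
have mp1 : measurable_fun setT (EFin \o p1).
  by apply/measurable_EFinP; exact: measurable_exponential_pdf.
have mp2 : measurable_fun setT (EFin \o p2).
  apply/measurable_EFinP; apply: measurableT_comp => //.
  exact: measurable_exponential_pdf.
have p10 u : 0 <= (p1 u)%:E by rewrite lee_fin exponential_pdf_ge0// ltW.
have p20 u : 0 <= (p2 u)%:E by rewrite lee_fin exponential_pdf_ge0// ltW.
have ip1 : \int[lambda]_u (p1 u)%:E = 1 by exact: integral_exponential_pdf.
have ip2 : \int[lambda]_u (p2 u)%:E = 1.
  rewrite -[RHS](integral_exponential_pdf b0).
  transitivity (\int[pushforward lambda (-%R : _ -> measurableTypeR R)]_u
      (exponential_pdf (2 - alpha) u)%:E).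
    rewrite ge0_integral_pushforward//.
    - by apply/measurable_EFinP; exact: measurable_exponential_pdf.
    - by move=> u _; rewrite lee_fin exponential_pdf_ge0// ltW.
  by apply: eq_measure_integral => A mA _; exact: lebesgue_measureN.
(* The weights cancel the normalizing factors [alpha] and [2 - alpha] of the densities. *)
have kp u : (levy_kernel alpha 1 u)%:E <=
    (2 / alpha)%:E * (p1 u)%:E + (2 - alpha)^-1%:E * (p2 u)%:E.
  rewrite /levy_kernel mulr1.
  have /andP[_] := cos_bound (expR u); rewrite le_min => /andP[k2 ke].
  have [u0|u0] := leP 0%R u.
    rewrite -[leLHS]adde0 leeD ?mule_ge0// ?lee_fin ?invr_ge0 ?(ltW b0)//.
    rewrite /p1 exponential_pdfE// mulrA divfK ?gt_eqF//.
    by rewrite ler_wpM2r// expR_ge0.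
  rewrite -[leLHS]add0e leeD ?mule_ge0// ?lee_fin ?divr_ge0 ?(ltW a0)//.
  rewrite /p2 exponential_pdfE ?oppr_ge0 ?(ltW u0)// mulrA mulVf ?gt_eqF// mul1r.
  rewrite (_ : - (2 - alpha) * - u = u * 2%:R + - alpha * u)%R; last by lra.
  by rewrite expRD expRM_natr ler_wpM2r// expR_ge0.
have m1 := continuous_measurable_fun (@continuous_levy_kernel 1%R).
apply: (@le_lt_trans _ _ (\int[lambda]_u
    ((2 / alpha)%:E * (p1 u)%:E + (2 - alpha)^-1%:E * (p2 u)%:E))).
  apply: ge0_le_integral => //.
  - by move=> u _; rewrite lee_fin levy_kernel_ge0.
  - exact/measurable_EFinP.
  - by apply: emeasurable_funD; exact: measurable_funeM.
rewrite ge0_integralD//; last 4 first.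
- by move=> u _; rewrite mule_ge0// lee_fin divr_ge0// ltW.
- exact: measurable_funeM.
- by move=> u _; rewrite mule_ge0// lee_fin invr_ge0// ltW.
- exact: measurable_funeM.
rewrite !ge0_integralZl//; last 2 first.
- by rewrite lee_fin invr_ge0 ltW.
- by rewrite lee_fin divr_ge0// ltW.
by rewrite ip1 ip2 !mule1 ltry.
Qed.

(** On [[-1, 0]], a set of measure 1, the kernel is at least [c = 1 - cos (e^(-1)) > 0]: there
    [e^(-1) <= e^u <= 1], cosine decreases on [[0, pi]], and [e^(-alpha u) >= 1]. *)
Lemma levy_constant_gt0 : 0 < levy_constant.
Proof.
case/andP: alpha02 => a0 a2.
have m1 := continuous_measurable_fun (@continuous_levy_kernel 1%R).
pose c : R := (1 - cos (expR (-1)))%R.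
have pi1 : (1 <= pi :> R)%R by apply: le_trans (pi_ge2 R); rewrite ler1n.
have e1 : (expR (-1) <= 1 :> R)%R by rewrite -[leRHS]expR0 ler_expR; lra.
have c0 : (0 < c)%R.
  rewrite subr_gt0 -[ltRHS](cos0 R) ltr_cos ?expR_gt0// in_itv/= ?lexx ?pi_ge0//.
  by rewrite expR_ge0/= (le_trans e1).
apply: (@lt_le_trans _ _ (\int[lambda]_(u in `[(-1)%R, 0%R]) (cst c%:E u))).
  have -> : \int[lambda]_(u in `[(-1)%R, 0%R]) (cst c%:E u) = c%:E * lambda `[(-1)%R, 0%R].
    exact: integral_cst.
  rewrite /lambda lebesgue_measure_itv/= lte_fin ltrN10.
  by rewrite -EFinB sub0r opprK mule1 lte_fin.
rewrite /levy_constant; apply: (@le_trans _ _ (\int[lambda]_(u in `[(-1)%R, 0%R]) (levy_kernel alpha 1 u)%:E)).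
  apply: ge0_le_integral => //.
  - by move=> u _; rewrite lee_fin ltW.
  - by apply/measurable_EFinP/measurable_funTS.
  - move=> u /=; rewrite in_itv/= => /andP[u1 u0]; rewrite lee_fin /levy_kernel mulr1.
    rewrite -[leLHS]mulr1 ler_pM ?(ltW c0)//.
      rewrite lerD2l lerN2 leNgt ltr_cos ?in_itv/= ?expR_ge0 -?leNgt ?ler_expR//.
        by rewrite (le_trans _ pi1)// -expR0 ler_expR.
      by rewrite (le_trans e1).
    by rewrite -expR0 ler_expR mulNr -mulrN mulr_ge0 ?(ltW a0)// oppr_ge0.
apply: ge0_subset_integral => //.
- exact/measurable_EFinP.
- by move=> u _; rewrite lee_fin levy_kernel_ge0.
Qed.

(** Since cosine is even, [x] enters only through [e^u |x| = e^(u + a)] with [a = ln |x|].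
    Translating by [a] leaves the factor [e^(alpha a) = |x|^alpha]. *)
Lemma integral_levy_kernel (x : R) :
  \int[lambda]_u (levy_kernel alpha x u)%:E = (`|x| `^ alpha)%:E * levy_constant.
Proof.
case/andP: alpha02 => a0 a2.
(* The logarithm requires [x] nonzero; at [x = 0] both sides vanish, the power because [alpha] is
   nonzero. *)
have [->|x0] := eqVneq x 0%R.
  rewrite normr0 powR0 ?gt_eqF// mul0e integral0_eq// => u _.
  by rewrite /levy_kernel mulr0 cos0 subrr mul0r.
pose a := ln `|x|%R.
have ea : expR a = `|x|%R by rewrite lnK// posrE normr_gt0.
have dF (u : R) : is_derive u 1%R (fun u => u + a)%R 1%R.
  by rewrite -[X in is_derive _ _ _ X]addr0; exact: is_deriveD.
have dF1 : derive1 (fun u : R => u + a)%R = cst 1%R.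
  by apply/funext => u; rewrite derive1E derive_val.
rewrite /levy_constant (@increasing_ge0_integration_by_substitutionT _ (fun u => u + a)%R
  (levy_kernel alpha 1)); last 9 first.
- by move=> u v uv; rewrite ltrD2r.
- by rewrite dF1; exact: cst_continuous.
- by rewrite dF1; exact: is_cvg_cst.
- by rewrite dF1; exact: is_cvg_cst.
- by move=> u; exact: ex_derive.
- exact: cvg_addrr_Ny.
- exact: cvg_addrr.
- exact: continuous_levy_kernel.
- by move=> u; exact: levy_kernel_ge0.
rewrite -ge0_integralZl//.
- apply: eq_integral => u _; rewrite dF1 /= /levy_kernel -EFinM; congr (_%:E).
  have -> : (cos (expR u * x) = cos (expR (u + a) * 1))%R.
    by rewrite mulr1 expRD ea -cos_norm normrM (gtr0_norm (expR_gt0 u)).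
  rewrite /powR normr_eq0 (negbTE x0) -/a mulrfctE /=.
  rewrite (_ : - alpha * u = alpha * a + - alpha * (u + a))%R; last by ring.
  by rewrite (expRD (alpha * a)%R); ring.
- rewrite dF1 mulr1; apply/measurable_EFinP; apply: continuous_measurable_fun => u.
  apply: (continuous_comp (f := fun u : R => u + a)%R); last exact: continuous_levy_kernel.
  by apply: cvgD; [exact: cvg_id|exact: cvg_cst].
- by move=> u _; rewrite dF1 lee_fin mulrfctE mulr1 levy_kernel_ge0.
Qed.

End levy_representation.

(** * Comparison of expectations for an i.i.d. pair *)

Section iid.
Context (R : realType) (alpha : R) (d : measure_display) (T : measurableType d).
Context (P : probability T R) (X Y : {RV P >-> R}).
Context (indXY : independent_RVs P X Y) (idXY : identically_distributed P X Y).

Lemma le_integral_cos (t : R) :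
  \int[P]_w (1 - cos (t * (X w - Y w)))%:E <=
  \int[P]_w (1 - cos (t * (X w + Y w)))%:E.
Proof.
have mC := continuous_measurable_fun (@continuous_cos R).
have mS := continuous_measurable_fun (@continuous_sin R).
have mD : measurable_fun setT (fun z : R * R => 1 - cos (t * (z.1 + z.2)))%R.
  apply: measurable_funB => //; apply: measurableT_comp => //.
  by apply: measurable_funM => //; apply: measurable_funD.
have mB : measurable_fun setT (fun z : R * R => 1 - cos (t * (z.1 - z.2)))%R.
  apply: measurable_funB => //; apply: measurableT_comp => //.
  by apply: measurable_funM => //; apply: measurable_funB.
have c0 (s : R) : (0 <= 1 - cos s)%R by case/andP: (cos_bound s).
have mst : measurable_fun setT (fun x : R => sin (t * x)).
  by apply: measurableT_comp => //; exact: measurable_funM.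
rewrite (joint_distributionE indXY idXY
  (f := fun z => (1 - cos (t * (z.1 - z.2)))%:E))//; last exact/measurable_EFinP.
rewrite (joint_distributionE indXY idXY
  (f := fun z => (1 - cos (t * (z.1 + z.2)))%:E))//; last exact/measurable_EFinP.
apply: (le_integral_tensor_square (g := fun x => sin (t * x)) (c := 2)) => //.
(* Sine is bounded by 1, hence integrable under the law of [X]. *)
- apply: measurable_bounded_integrable => //.
    by rewrite (le_lt_trans (probability_le1 _ _))// ltry.
  by exists 1%R; split => // M M1 x _ /=; rewrite (le_trans (sin_max _))// ltW.
- by move=> z; rewrite mulrBr mulrDr cosB cosD; ring.
Qed.

(** The endpoint is treated directly: for [alpha = 2] the kernel tends to [1/2] at [-oo] when
    [x = 1], so [levy_constant] would be infinite. The second moment makes [E X] finite. *)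
Lemma le_integral_sqr : 'E_P[fun w => (`|X w| `^ 2)%R] < +oo ->
  \int[P]_w (`|X w - Y w| `^ 2)%:E <= \int[P]_w (`|X w + Y w| `^ 2)%:E.
Proof.
have pE (z : R) : (`|z| `^ 2 = z ^+ 2)%R.
  by rewrite powR_mulrn// real_normK// num_real.
rewrite unlock => X2.
under eq_integral do rewrite pE.
under [leRHS]eq_integral do rewrite pE.
have mD : measurable_fun setT (fun z : R * R => (z.1 + z.2) ^+ 2)%R.
  by apply: measurable_funX; exact: measurable_funD.
have mB : measurable_fun setT (fun z : R * R => (z.1 - z.2) ^+ 2)%R.
  by apply: measurable_funX; exact: measurable_funB.
rewrite (joint_distributionE indXY idXY
  (f := fun z => ((z.1 - z.2) ^+ 2)%:E))//; last 2 first.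
- exact/measurable_EFinP.
- by move=> z; rewrite lee_fin sqr_ge0.
rewrite (joint_distributionE indXY idXY
  (f := fun z => ((z.1 + z.2) ^+ 2)%:E))//; last 2 first.
- exact/measurable_EFinP.
- by move=> z; rewrite lee_fin sqr_ge0.
apply: (le_integral_tensor_square (g := id) (c := 4)) => //.
(* Domination [|x| <= 1 + x^2], which follows from [(|x| - 1)^2 >= 0]. *)
- apply: (@le_integrable _ _ _ _ _ measurableT (EFin \o id)
    (fun x : R => (1 + x ^+ 2)%:E)) => //.
  + exact/measurable_EFinP.
  + move=> x _; rewrite /= lee_fin [leRHS]ger0_norm ?addr_ge0 ?sqr_ge0//.
    have := sqr_ge0 (`|x| - 1)%R; rewrite -[X in (_ -> _ <= _ + X)%R]real_normK ?num_real//.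
    by have := normr_ge0 x; nra.
  apply: (@integrableD _ _ _ _ _ measurableT (EFin \o cst 1%R)
    (fun x : R => (x ^+ 2)%:E)) => //; first exact: finite_measure_integrable_cst.
  apply/integrableP; split; first by apply/measurable_EFinP; exact: measurable_funX.
  under eq_integral do rewrite /= ger0_norm ?sqr_ge0//.
  rewrite (ge0_integral_distribution X (f := fun x => (x ^+ 2)%:E)); last 2 first.
  - by apply/measurable_EFinP; exact: measurable_funX.
  - by move=> x; rewrite lee_fin sqr_ge0.
  by under eq_integral do rewrite /= -pE.
- by move=> z; rewrite sqr_ge0.
- by move=> z; ring.
Qed.

Lemma measurable_levy_kernel_comp (Z : T -> R) : measurable_fun setT Z ->
  measurable_fun setT
    (fun z : T * measurableTypeR R => (levy_kernel alpha (Z z.1) z.2)%:E).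
Proof.
move=> mZ; apply/measurable_EFinP.
apply: (measurableT_comp (measurable_levy_kernel alpha)
  (g := fun z : T * measurableTypeR R => (Z z.1, z.2))).
by apply: measurable_fun_pair => //=; exact: measurableT_comp.
Qed.

(** The representation is applied to each [Z w], and Tonelli exchanges the integrals. The identity
    lives in [\bar R], so both sides may be infinite. *)
Lemma integral_powR_levy (Z : T -> R) : (0 < alpha < 2)%R ->
  measurable_fun setT Z ->
  levy_constant alpha * \int[P]_w (`|Z w| `^ alpha)%:E =
  \int[lebesgue_measure]_u \int[P]_w (levy_kernel alpha (Z w) u)%:E.
Proof.
move=> alpha02 mZ.
transitivity (\int[P]_w \int[lebesgue_measure]_u (levy_kernel alpha (Z w) u)%:E).
  rewrite -ge0_integralZl//; last 2 first.
  - apply/measurable_EFinP; apply: (measurableT_comp (measurable_powR alpha)).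
    exact: measurableT_comp.
  - by rewrite ltW// levy_constant_gt0.
  by apply: eq_integral => w _; rewrite integral_levy_kernel// muleC.
apply: (fubini_tonelli
  (fun z : T * measurableTypeR R => (levy_kernel alpha (Z z.1) z.2)%:E)).
- exact: measurable_levy_kernel_comp.
- by move=> z; rewrite lee_fin levy_kernel_ge0.
Qed.

(** For fixed [u] this is the cosine comparison at frequency [t = e^u], scaled by the nonnegative
    constant [e^(-alpha u)]. *)
Lemma le_integral_levy_kernel (u : R) :
  \int[P]_w (levy_kernel alpha (X w - Y w) u)%:E <=
  \int[P]_w (levy_kernel alpha (X w + Y w) u)%:E.
Proof.
have mC := continuous_measurable_fun (@continuous_cos R).
have levyE (Z : T -> R) : measurable_fun setT Z ->
    \int[P]_w (levy_kernel alpha (Z w) u)%:E =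
    (expR (- alpha * u))%:E * \int[P]_w (1 - cos (expR u * Z w))%:E.
  move=> mZ; rewrite -ge0_integralZl//.
  - by apply: eq_integral => w _; rewrite -EFinM mulrC.
  - apply/measurable_EFinP; apply: measurable_funB => //.
    by apply: measurableT_comp => //; exact: measurable_funM.
rewrite !levyE; [|exact: measurable_funD|exact: measurable_funB].
by rewrite lee_wpmul2l ?lee_fin ?expR_ge0//; exact: le_integral_cos.
Qed.

End iid.

Theorem theorem1 (R : realType) (alpha : R) (d : measure_display)
    (T : measurableType d) (P : probability T R) (X Y : {RV P >-> R}) :
  (0 < alpha <= 2)%R ->
  independent_RVs P X Y ->
  identically_distributed P X Y ->
  'E_P[fun w => (`|X w| `^ alpha)%R] < +oo ->
  'E_P[fun w => (`|X w - Y w| `^ alpha)%R] <= 'E_P[fun w => (`|X w + Y w| `^ alpha)%R].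
Proof.
case/andP => a0; rewrite le_eqVlt => /predU1P[->|a2] indXY idXY.
  by move=> X2; rewrite unlock; exact: le_integral_sqr.
move=> _; have a02 : (0 < alpha < 2)%R by rewrite a0.
have K0 := levy_constant_gt0 a02.
have Kfin : levy_constant alpha \is a fin_num.
  by rewrite ge0_fin_numE ?levy_constant_lty// ltW.
have mB : measurable_fun setT (fun w => X w - Y w)%R by exact: measurable_funB.
have mD : measurable_fun setT (fun w => X w + Y w)%R by exact: measurable_funD.
(* Multiplication by a finite positive constant reflects the order of [\bar R], even at infinite
   expectations. *)
rewrite unlock -(lee_pmul2l Kfin K0).
rewrite (integral_powR_levy _ a02 mB) (integral_powR_levy _ a02 mD).
(* Tonelli also gives measurability in [u] of the inner integrals, required to integrate the
   pointwise inequality. *)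
have mI (Z : T -> R) : measurable_fun setT Z -> measurable_fun setT
    (fun u => \int[P]_w (levy_kernel alpha (Z w) u)%:E).
  move=> mZ; apply: (measurable_fun_fubini_tonelli_G
    (fun z => (levy_kernel alpha (Z z.1) z.2)%:E)).
  - exact: measurable_levy_kernel_comp.
  - by move=> z; rewrite lee_fin levy_kernel_ge0.
apply: ge0_le_integral => //.
- by move=> u _; rewrite integral_ge0// => w _; rewrite lee_fin levy_kernel_ge0.
- exact: mI.
- exact: mI.
- by move=> u _; exact: le_integral_levy_kernel.
Qed.
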